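(* Let $\Omega\subsetneq\mathbb{R}^n$ be a domain, $x\in\Omega$, $\alpha\in(0,1]$ and $\xi\in\partial^{\mathrm{str}}_{x,\alpha}\Omega$. Put $\rho:=|x-\xi|$ and $v:=(x-\xi)/\rho$. Then $$K\bigl(\xi,v,\tfrac{\alpha}{2},\tfrac{\rho}{2}\bigr)\subset\Omega .$$
   Context: A domain is a nonempty connected open set. $d_\Omega(y):=\operatorname{dist}(y,\partial\Omega)$. For $x\ne\xi$, $[x,\xi):=\{(1-t)x+t\xi:0\le t<1\}$. For $x\in\Omega$ and $\alpha\in(0,1]$, $$\partial^{\mathrm{str}}_{x,\alpha}\Omega:=\bigl\{\xi\in\partial\Omega:\ [x,\xi)\subset\Omega\ \text{ and }\ d_\Omega((1-t)x+t\xi)\ge\alpha\min\{t,1-t\}|x-\xi|\ \text{ for every }t\in(0,1)\bigr\}.$$ For $\xi\in\mathbb{R}^n$, a unit vector $v$, $\kappa\in(0,1]$ and $h>0$, the open truncated cone is $$K(\xi,v,\kappa,h):=\{\xi+ru:\ 0<r<h,\ u\in S^{n-1},\ |u-v|<\kappa\}.$$ *)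

(* Defs.v *)
From HB Require Import structures.
From mathcomp Require Import all_boot all_order all_algebra.
From mathcomp Require Import all_classical all_reals all_analysis.

Set Implicit Arguments.
Unset Strict Implicit.
Unset Printing Implicit Defensive.

Import Order.TTheory GRing.Theory Num.Theory.
Import numFieldNormedType.Exports.

Local Open Scope classical_set_scope.
Local Open Scope ring_scope.

(* The library norm `|u| on 'rV[R]_n is the max norm. It induces the usual
   topology, so open, connected, closure and interior below are the library
   ones; every metric quantity uses the Euclidean norm. *)
Definition enorm (R : realType) (n : nat) (u : 'rV[R]_n) : R :=
  Num.sqrt (\sum_(i < n) u 0 i ^+ 2).

Definition domain (R : realType) (n : nat) (Omega : set 'rV[R]_n) : Prop :=
  [/\ Omega !=set0, connected Omega & open Omega].

Definition boundary (T : topologicalType) (A : set T) : set T :=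
  closure A `\` interior A.

Definition dist_set (R : realType) (n : nat) (y : 'rV[R]_n)
    (A : set 'rV[R]_n) : R :=
  inf [set enorm (y - z) | z in A].

(* inf is 0 on the empty set; boundary Omega is nonempty for the proper
   domains considered here. *)
Definition bdist (R : realType) (n : nat) (Omega : set 'rV[R]_n)
    (y : 'rV[R]_n) : R :=
  dist_set y (boundary Omega).

Definition seg_point (R : realType) (n : nat) (x xi : 'rV[R]_n) (t : R) :
    'rV[R]_n :=
  (1 - t) *: x + t *: xi.

Definition segment_co (R : realType) (n : nat) (x xi : 'rV[R]_n) :
    set 'rV[R]_n :=
  [set seg_point x xi t | t in `[0, 1[].

Definition str_boundary (R : realType) (n : nat) (Omega : set 'rV[R]_n)
    (x : 'rV[R]_n) (alpha : R) : set 'rV[R]_n :=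
  [set xi | [/\ boundary Omega xi,
      segment_co x xi `<=` Omega &
      forall t : R, 0 < t < 1 ->
        alpha * Num.min t (1 - t) * enorm (x - xi)
          <= bdist Omega (seg_point x xi t)]].

Definition trunc_cone (R : realType) (n : nat) (xi v : 'rV[R]_n)
    (kappa h : R) : set 'rV[R]_n :=
  [set y | exists r : R, exists u : 'rV[R]_n,
      [/\ 0 < r < h, enorm u = 1, enorm (u - v) < kappa & y = xi + r *: u]].

(* Main.v *)
Require Import Defs.
From mathcomp Require Import all_boot all_order all_algebra.
From mathcomp Require Import all_classical all_reals all_analysis.
From mathcomp Require Import lra.

(** The axis of the cone is the segment from [xi] towards [x].  A point
    [xi + r *: u] of the cone lies at distance [r * enorm (u - v)], less than
    [alpha / 2 * r], from the axis point [xi + r *: v].  Since [r < rho / 2],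
    that axis point sits at parameter [t = 1 - r / rho > 1 / 2] on the segment,
    so the minimum in the starlikeness condition is [1 - t = r / rho], and the
    condition puts the axis point at distance at least [alpha * r] from the
    boundary.  It remains to know that a point of an open set, moved by less
    than its boundary distance, stays in the set ([open_bdist_subset]): a
    segment leaving the set would have to cross its boundary
    ([segment_meets_boundary]), which is too far away. *)

Import Order.TTheory GRing.Theory Num.Theory.
Import numFieldNormedType.Exports.

Local Open Scope classical_set_scope.
Local Open Scope ring_scope.

Lemma enorm_ge0 (R : realType) (n : nat) (u : 'rV[R]_n) : 0 <= enorm u.
Proof. exact: sqrtr_ge0. Qed.

Lemma enormZ (R : realType) (n : nat) (a : R) (u : 'rV[R]_n) :
  enorm (a *: u) = `|a| * enorm u.
Proof.
rewrite /enorm -sqrtr_sqr -sqrtrM ?sqr_ge0// mulr_sumr; congr Num.sqrt.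
by apply: eq_bigr => i _; rewrite mxE exprMn.
Qed.

Lemma bdist_le (R : realType) (n : nat) (A : set 'rV[R]_n) (z w : 'rV[R]_n) :
  boundary A w -> bdist A z <= enorm (z - w).
Proof.
move=> bw; apply: ge_inf; last by exists w.
by exists 0 => _ [y _ <-]; exact: enorm_ge0.
Qed.

(** If the segment avoided the boundary, then on it [A] would coincide with
    [closure A]; the parameters landing in [A] would form a nonempty clopen
    part of the connected unit interval, hence all of it. *)
Lemma segment_meets_boundary (R : realType) (n : nat) (A : set 'rV[R]_n)
    (z d : 'rV[R]_n) :
  open A -> A z -> ~ A (z + d) ->
  exists2 s : R, 0 <= s <= 1 & boundary A (z + s *: d).
Proof.
move=> oA Az nAzd; apply: contrapT => noB.
pose g (s : R) : 'rV[R]_n := z + s *: d.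
have cg : continuous g.
  by move=> s; apply: cvgD; [exact: cvg_cst | apply: cvgZr_tmp; exact: cvg_id].
have AcA (s : R) : s \in `[0, 1] -> closure A (g s) -> A (g s).
  rewrite in_itv /= => s01 clAs; apply: contrapT => nAs; apply: noB.
  by exists s => //; split=> // /interior_subset.
suff E : [set` `[0, 1]] `&` g @^-1` A = [set` `[0, 1]].
  have : [set` `[0, 1]] (1 : R) by rewrite /= in_itv /= ler01 lexx.
  by rewrite -E => -[_]; rewrite /g /= scale1r.
apply: (segment_connected (a := 0) (b := 1)).
- by exists 0; split; rewrite /g /= ?scale0r ?addr0 // in_itv /= lexx ler01.
- by exists (g @^-1` A) => //; apply: open_comp => // s _; exact: cg.
- exists (g @^-1` closure A).
    by apply: preimage_closed; [move=> s _; exact: cg | exact: closed_closure].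
  apply/seteqP; split=> s [s01 As]; split=> //; first exact: subset_closure.
  exact: AcA.
Qed.

Lemma open_bdist_subset (R : realType) (n : nat) (A : set 'rV[R]_n)
    (z d : 'rV[R]_n) :
  open A -> A z -> enorm d < bdist A z -> A (z + d).
Proof.
move=> oA Az dlt; apply: contrapT => nA.
have [s /andP[s0 s1] /(bdist_le _ _ _ z)] := segment_meets_boundary _ _ _ _ _ oA Az nA.
rewrite opprD addNKr -scaleNr enormZ normrN ger0_norm // => le_s.
have := le_lt_trans (le_trans le_s (ler_piMl (enorm_ge0 _ _ d) s1)) dlt.
by rewrite ltxx.
Qed.

Theorem lemma3p1 (R : realType) (n : nat) (Omega : set 'rV[R]_n)
    (x : 'rV[R]_n) (alpha : R) (xi : 'rV[R]_n)
    (hdom : domain Omega) (hproper : Omega `<` setT)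
    (hx : Omega x) (halpha : 0 < alpha <= 1)
    (hxi : str_boundary Omega x alpha xi) :
  let rho := enorm (x - xi) in
  let v := rho^-1 *: (x - xi) in
  trunc_cone xi v (alpha / 2) (rho / 2) `<=` Omega.
Proof.
move=> rho v _ [r [u [/andP[r0 rh] _ uv ->]]].
have [_ _ oO] := hdom; have [_ segO bd] := hxi.
have /andP[a0 _] := halpha.
have rho0 : 0 < rho by lra.
pose q := r / rho.
have q0 : 0 < q by rewrite divr_gt0.
have q2 : q < 1 / 2 by rewrite ltr_pdivrMr // mulrC mul1r.
have axisE : seg_point x xi (1 - q) = xi + r *: v.
  by rewrite /seg_point /v scalerA -/q scalerBr subKr scalerBl scale1r addrCA.
have Oaxis : Omega (xi + r *: v).
  by rewrite -axisE; apply: segO; exists (1 - q) => //=; rewrite in_itv /=; lra.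
have far : alpha * r <= bdist Omega (xi + r *: v).
  have t01 : 0 < 1 - q < 1 by lra.
  have := bd _ t01; rewrite axisE -/rho subKr.
  by rewrite min_r; [rewrite -mulrA divfK // gt_eqF | lra].
have -> : xi + r *: u = (xi + r *: v) + r *: (u - v).
  by rewrite scalerBr -addrA [r *: v + _]addrC subrK.
apply: open_bdist_subset => //; apply: lt_le_trans far.
rewrite enormZ gtr0_norm // mulrC ltr_pM2r //.
by apply: (lt_trans uv); lra.
Qed.
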